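(* For every positive integer $d$, the $d+1$ polynomials $P_{2d-1},P_{2d},P_{2d-1,1},P_{2d-1,2},\dots,P_{2d-1,d-1}$ are affinely independent.
   Context: $G_n$ is the ladder graph with vertices $(j,0),(j,1)$, $0\le j\le n$, horizontal edges $(j,a)(j+1,a)$ and vertical edges $(j,0)(j,1)$, embedded in the plane; its elementary regions are $n$ unit squares, the $i$-th with corners in columns $i-1,i$. For $1\le i\le n$, $G_{n,i}$ is obtained from $G_n$ by adding a unit square below the $i$-th square (new vertices $(i-1,-1),(i,-1)$ and edges $(i-1,0)(i-1,-1)$, $(i-1,-1)(i,-1)$, $(i,-1)(i,0)$). For such a graph $G$, a tiling is a partition of the vertex set into edges of $G$ and vertex sets of unit squares; the tilings form a cubical complex $\mathcal{C}(G)$ in which a tiling using exactly $k$ squares is a $k$-dimensional face. With $f_k$ the number of $k$-dimensional faces, $F_G(x)=\sum_kf_kx^k$, and $P_n(x)=F_{G_n}(x-1)$, $P_{n,i}(x)=F_{G_{n,i}}(x-1)$. These polynomials lie in the space of real polynomials of degree at most $d$. *)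

(* Defs.v *)
From HB Require Import structures.
From mathcomp Require Import all_boot all_order all_algebra.
From mathcomp Require Import reals.

Set Implicit Arguments.
Unset Strict Implicit.
Unset Printing Implicit Defensive.

Import Order.TTheory GRing.Theory Num.Theory.

Local Open Scope ring_scope.

(* A finite plane graph with vertices in an ambient finite type [T]; edges and
   unit squares (its elementary regions) are given by their vertex sets. *)
Record square_graph (T : finType) := SquareGraph {
  verts : {set T};
  edges : {set {set T}};
  squares : {set {set T}}
}.

Definition tiling (T : finType) (G : square_graph T) (P : {set {set T}}) : bool :=
  partition P (verts G) && (P \subset edges G :|: squares G).

(* f_k: the k-dimensional faces of the cubical complex C(G) are the tilings
   using exactly k squares. *)
Definition face_number (T : finType) (G : square_graph T) (k : nat) : nat :=
  #|[set P : {set {set T}} | tiling G P & #|P :&: squares G| == k]|.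

(* F_G; no tiling uses more than #|squares G| squares. *)
Definition F_poly (R : realType) (T : finType) (G : square_graph T) : {poly R} :=
  \poly_(k < #|squares G|.+1) (face_number G k)%:R.

Definition P_poly (R : realType) (T : finType) (G : square_graph T) : {poly R} :=
  F_poly R G \Po ('X - 1%:P).

(* The lattice points (j, y) with 0 <= j <= n and -1 <= y <= 1; the second
   component stores y + 1. *)
Definition grid (n : nat) : finType := ('I_n.+1 * 'I_3)%type.

Definition rowm1 : 'I_3 := inord 0.
Definition row0 : 'I_3 := inord 1.
Definition row1 : 'I_3 := inord 2.

(* [inord j] is the column j whenever j <= n. *)
Definition pt (n j : nat) (y : 'I_3) : grid n := (inord j, y).

Definition ladder (n : nat) : square_graph (grid n) := {|
  verts := [set pt n j row0 | j : 'I_n.+1] :|: [set pt n j row1 | j : 'I_n.+1];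
  edges :=
    [set [set pt n j row0; pt n j.+1 row0] | j : 'I_n] :|:
    [set [set pt n j row1; pt n j.+1 row1] | j : 'I_n] :|:
    [set [set pt n j row0; pt n j row1] | j : 'I_n.+1];
  squares :=
    [set [set pt n j row0; pt n j.+1 row0; pt n j row1; pt n j.+1 row1]
       | j : 'I_n]
|}.

(* G_{n,i}, meaningful for 1 <= i <= n. *)
Definition ladder_plus (n i : nat) : square_graph (grid n) := {|
  verts := verts (ladder n) :|: [set pt n i.-1 rowm1; pt n i rowm1];
  edges := edges (ladder n) :|:
    [set [set pt n i.-1 row0; pt n i.-1 rowm1];
         [set pt n i.-1 rowm1; pt n i rowm1];
         [set pt n i rowm1; pt n i row0]];
  squares := squares (ladder n) :|:
    [set [set pt n i.-1 row0; pt n i row0; pt n i.-1 rowm1; pt n i rowm1]]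
|}.

Definition P_ladder (R : realType) (n : nat) : {poly R} := P_poly R (ladder n).

Definition P_ladder_plus (R : realType) (n i : nat) : {poly R} :=
  P_poly R (ladder_plus n i).

(* Affine independence of the family s`_0, s`_1, ... (in particular its members
   are pairwise distinct). *)
Definition affinely_independent (R : realType) (V : lmodType R) (s : seq V) : Prop :=
  forall c : 'I_(size s) -> R,
    \sum_i c i = 0 -> \sum_i c i *: s`_i = 0 -> forall i, c i = 0.

(* Main.v *)
Require Import Defs.
From HB Require Import structures.
From mathcomp Require Import all_boot all_order all_algebra.
From mathcomp Require Import reals.
From mathcomp Require Import zify ring.

Set Implicit Arguments.
Unset Strict Implicit.
Unset Printing Implicit Defensive.

Import Order.TTheory GRing.Theory Num.Theory.

Local Open Scope ring_scope.

(** Removing the tile that covers a fixed vertex gives a recurrence for the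
tiling generating function. On the ladder with m columns it reads
p_(m+2) = p_(m+1) + X p_m after the shift of the variable, so P_n = p_(n+1).
In G_(n,i), either the two lower vertices form a tile of their own, or the
lower square (or its two vertical sides) cuts a notch out of the ladder. The
two vertices above the notch must then be matched together, since all tiles are
even while matching one of them to the left would leave an odd number of
vertices on that side. Hence P_(n,i) = p_(n+1) + X p_(i-1) p_(n-i).

With N = d - 1, all the polynomials of the theorem are therefore of the form
p_(2N+2) + X v with v = 0, v = p_(2N+1) or v = p_j p_(2N-j), j < N, and it
remains to see that the nonzero v are linearly independent. Both kinds expand
in the family X^k p_(2N-2k), k <= N, with a triangular matrix of signs:
  p_(2N+1) = \sum_(k <= N) X^k p_(2N-2k),
  p_j p_(2N-j) = \sum_(k <= j) (-X)^k p_(2N-2k)  (d'Ocagne's identity),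
and this family is independent because X^k p_(2N-2k) has lowest term X^k. *)

(** * Linear and affine independence *)

Definition linearly_independent (R : nzRingType) (V : lmodType R)
    (s : seq V) : Prop :=
  forall c : nat -> R, \sum_(i < size s) c i *: s`_i = 0 ->
    forall i, (i < size s)%N -> c i = 0.

Lemma affinely_independent_translate (R : realType) (V : lmodType R) (u : V)
    (s : seq V) :
  linearly_independent s -> affinely_independent (u :: [seq u + v | v <- s]).
Proof.
move=> s_free c c_sum0 cv_sum0 i; pose c' k := c (inord k).
have c'E j : c' (val j) = c j by rewrite /c' inord_val.
have {c_sum0} c'_sum0 : c' 0%N + \sum_(j < size s) c' j.+1 = 0.
  rewrite -[RHS]c_sum0 -(size_map (+%R u) s) -(big_ord_recl _ c').
  by apply: eq_bigr => j _; rewrite c'E.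
have {cv_sum0} c's_sum0 : \sum_(j < size s) c' j.+1 *: s`_j = 0.
  rewrite -[RHS]cv_sum0; under [RHS]eq_bigr do rewrite -c'E.
  rewrite /= big_ord_recl /= size_map.
  under [in RHS]eq_bigr => j _ do rewrite add0n (nth_map 0) // scalerDr.
  by rewrite big_split addrA -scaler_suml -scalerDl c'_sum0 scale0r add0r.
have c'0 := s_free (fun j => c' j.+1) c's_sum0; rewrite -c'E.
case: i => -[|k] /=; last by rewrite ltnS size_map => /c'0.
by move=> _; move: c'_sum0; rewrite big1 ?addr0 // => j _; rewrite c'0.
Qed.

Lemma linearly_independent_mull (R : nzRingType) (A : algType R) (a : A)
    (s : seq A) :
    GRing.lreg a ->
  linearly_independent s -> linearly_independent [seq a * v | v <- s].
Proof.
move=> a_reg s_free c; rewrite size_map => cas0; apply: s_free.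
apply: a_reg; rewrite mulr0 -[RHS]cas0 mulr_sumr.
by apply: eq_bigr => i _; rewrite (nth_map 0) // scalerAr.
Qed.

Lemma linearly_independent_rcons (R : nzRingType) (V : lmodType R) (s : seq V)
    (v : V) :
  linearly_independent (rcons s v) -> linearly_independent (v :: s).
Proof.
move=> sv_free c; rewrite /= big_ord_recl /= => cvs0.
pose c' i := if i == size s then c 0%N else c i.+1.
have c'0 : forall i, (i <= size s)%N -> c' i = 0.
  move=> i i_le; apply: sv_free; last by rewrite size_rcons.
  rewrite size_rcons big_ord_recr /= nth_rcons ltnn !eqxx addrC -[RHS]cvs0.
  rewrite /c' eqxx; congr (_ + _); apply: eq_bigr => j _.
  by rewrite nth_rcons ltn_ord ltn_eqF.
case=> [_|i i_lt]; first by have := c'0 _ (leqnn _); rewrite /c' eqxx.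
by have := c'0 i (ltnW i_lt); rewrite /c' ltn_eqF.
Qed.

Lemma linearly_independent_triangular (R : idomainType) (V : lmodType R)
    (u s : seq V) (a : nat -> nat -> R) :
    size s = size u -> (forall j, (j < size s)%N -> a j j != 0) ->
    (forall j, (j < size s)%N -> s`_j = \sum_(k < j.+1) a j k *: u`_k) ->
  linearly_independent u -> linearly_independent s.
Proof.
move=> szE a_neq0 sE u_free c cs0.
have coef0 : forall k, (k < size u)%N ->
    \sum_(j < size s | (k <= j)%N) c j * a j k = 0.
  apply: u_free; rewrite -[RHS]cs0 -szE.
  under [RHS]eq_bigr => j _.
    rewrite sE // (big_ord_widen _ (fun k => a j k *: u`_k) (ltn_ord j)).
    rewrite scaler_sumr big_mkcond.
    over.
  rewrite exchange_big /=; apply: eq_bigr => k _.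
  rewrite scaler_suml big_mkcond.
  by apply: eq_bigr => j _; rewrite ltnS scalerA.
suff c0 m k : (size s <= k + m)%N -> (k < size s)%N -> c k = 0.
  by move=> k; apply: (c0 (size s)); rewrite leq_addl.
elim: m k => [|m IHm] k; first by rewrite addn0 leqNgt => /negP.
move=> le_m k_lt; have := coef0 k; rewrite -szE => /(_ k_lt).
rewrite (bigD1 (Ordinal k_lt)) //= big1 ?addr0 => [/eqP|j /andP[kj j_neq]].
  by rewrite mulf_eq0 (negPf (a_neq0 k k_lt)) orbF => /eqP.
by move: j_neq; rewrite -val_eqE /= => j_neq; rewrite IHm ?mul0r //; lia.
Qed.

Lemma linearly_independent_lower_echelon (R : idomainType)
    (s : seq {poly R}) :
    (forall k i, (i < k < size s)%N -> s`_k`_i = 0) ->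
    (forall k, (k < size s)%N -> s`_k`_k != 0) ->
  linearly_independent s.
Proof.
move=> s_low s_diag c cs0; elim/ltn_ind=> k IHk k_lt.
have /eqP := congr1 (coefp k) cs0; rewrite /coefp coef0 coef_sum.
rewrite (bigD1 (Ordinal k_lt)) //= big1 ?addr0 => [|i].
  by rewrite coefZ mulf_eq0 (negPf (s_diag k k_lt)) orbF => /eqP.
rewrite coefZ -val_eqE neq_ltn /= => /orP[ik|ki]; first by rewrite IHk ?mul0r.
by rewrite s_low ?mulr0 // ki ltn_ord.
Qed.

(** * Fibonacci polynomials *)

Fixpoint fib_poly (A : comNzRingType) (q : A) (m : nat) : A :=
  if m is m1.+1 then
    if m1 is m2.+1 then fib_poly q m1 + q * fib_poly q m2 else 1
  else 1.
Arguments fib_poly : simpl never.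

Section FibPoly.

Variables (A : comNzRingType) (q : A).
Local Notation p := (fib_poly q).

Lemma fib_polySS m : p m.+2 = p m.+1 + q * p m.
Proof. by []. Qed.

Lemma fib_poly_odd_expand N :
  p N.*2.+1 = \sum_(k < N.+1) q ^+ k * p (N - k).*2.
Proof.
elim: N => [|N IHN]; first by rewrite big_ord1 mul1r.
rewrite doubleS fib_polySS IHN [RHS]big_ord_recl mul1r subn0; congr (_ + _).
by rewrite mulr_sumr; apply: eq_bigr => k _; rewrite mulrA -exprS subSS.
Qed.

Lemma fib_poly_docagne j m :
  p j.+1 * p (j.+1 + m) = p j * p (j + m).+2 + (- q) ^+ j.+1 * p m.
Proof.
elim: j => [|j IHj].
  by rewrite add0n add1n fib_polySS expr1 !mul1r mulNr addrK.
have docagneE :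
    (- q) ^+ j.+1 * p m = p j.+1 * p (j.+1 + m) - p j * p (j + m).+2.
  by rewrite IHj addrC addKr.
rewrite exprS -mulrA docagneE !addSn (fib_polySS j) (fib_polySS (j + m).+1).
by ring.
Qed.

Lemma fib_polyM_expand N j : (j <= N)%N ->
  p j * p (N.*2 - j) = \sum_(k < j.+1) (- q) ^+ k * p (N - k).*2.
Proof.
elim: j => [|j IHj] jN; first by rewrite big_ord1 !mul1r !subn0.
have -> : (N.*2 - j.+1 = j.+1 + (N - j.+1).*2)%N by lia.
rewrite fib_poly_docagne big_ord_recr -IHj 1?ltnW //=.
by congr (p j * p _ + _); lia.
Qed.

End FibPoly.

Section FibPolyIndependence.

Variable R : idomainType.
Local Notation p := (fib_poly ('X : {poly R})).

Lemma fib_poly_coef0 m : (p m)`_0 = 1.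
Proof.
elim/ltn_ind: m => -[|[|m]] IHm; rewrite ?coef1 //.
by rewrite fib_polySS coefD coefXM IHm ?addr0.
Qed.

Lemma linearly_independent_expXM_fib_poly N :
  linearly_independent (mkseq (fun k => 'X^k * p (N - k).*2) N.+1).
Proof.
apply: linearly_independent_lower_echelon => [k i|k]; rewrite size_mkseq.
  by case/andP=> ik kN; rewrite nth_mkseq // coefXnM ik.
by move=> kN; rewrite nth_mkseq // coefXnM ltnn subnn fib_poly_coef0 oner_eq0.
Qed.

Lemma linearly_independent_fib_polyM N :
  linearly_independent (p N.*2.+1 :: mkseq (fun j => p j * p (N.*2 - j)) N).
Proof.
pose a j k : R := if (j < N)%N then (-1) ^+ k else 1.
apply: linearly_independent_rcons.
apply: (linearly_independent_triangular (a := a) _ _ _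
  (@linearly_independent_expXM_fib_poly N)).
- by rewrite size_rcons !size_mkseq.
- by move=> j _; rewrite /a; case: ifP; rewrite ?signr_eq0 ?oner_eq0.
move=> j; rewrite size_rcons nth_rcons size_mkseq ltnS /a => jN.
case: ltngtP jN => // [jN _|-> _].
  rewrite nth_mkseq // fib_polyM_expand 1?ltnW //; apply: eq_bigr => k _.
  rewrite nth_mkseq; last by have := ltn_ord k; lia.
  by rewrite [(- 'X) ^+ k]exprNn -mulrA -!(signr_odd _ k) mulr_sign scaler_sign.
rewrite fib_poly_odd_expand; apply: eq_bigr => k _.
by rewrite nth_mkseq // scale1r.
Qed.

End FibPolyIndependence.

(** * Weighted set partitions and tilings *)

Section PartitionSum.

Variables (A : comNzRingType) (T : finType).
Implicit Types (w : {set T} -> A) (B U V : {set T}) (P : {set {set T}}).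

Definition partition_sum w V : A :=
  \sum_(P | partition P V) \prod_(B in P) w B.

Lemma eq_partition_sum w1 w2 V :
  {in powerset V, w1 =1 w2} -> partition_sum w1 V = partition_sum w2 V.
Proof.
move=> eq_w; apply: eq_bigr => P PV; apply: eq_bigr => B BP.
by rewrite eq_w // inE (partitionS PV).
Qed.

Lemma partition_sum0 w : partition_sum w set0 = 1.
Proof.
rewrite /partition_sum (big_pred1 set0) => [|P]; first by rewrite big_set0.
by rewrite partition_set0.
Qed.

Lemma partition_sum_peel w V v : v \in V ->
  partition_sum w V = \sum_(B : {set T} | (v \in B) && (B \subset V))
                         w B * partition_sum w (V :\: B).
Proof.
move=> vV; rewrite /partition_sum (partition_big (fun P => pblock P v)
  (fun B => (v \in B) && (B \subset V))) => [|P PV]; last first.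
  have vP : v \in cover P by rewrite (cover_partition PV).
  by rewrite mem_pblock vP (partitionS PV) ?pblock_mem.
apply: eq_bigr => B /andP[vB BV]; rewrite big_distrr /=.
rewrite (reindex_onto (fun P => B |: P) (fun P => P :\ B)) => [|P]; last first.
  case/andP=> PV /eqP <-.
  by rewrite setD1K // pblock_mem // (cover_partition PV).
have notin P : partition P (V :\: B) -> B \notin P.
  move=> PVB; apply/negP => /(partitionS PVB)/subsetP/(_ v vB).
  by rewrite inE vB.
apply: eq_big => [P|P /andP[_ /eqP BPK]]; last first.
  by rewrite big_setU1 // -BPK !inE eqxx.
apply/andP/idP => [[/andP[BPV _] /eqP <-]|PVB].
  by rewrite partitionD1 ?setU11.
have BPV : partition (B |: P) V.
  rewrite -(setID V B) (setIidPr BV); apply: partitionU1 => //.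
    by apply/set0Pn; exists v.
  by rewrite disjoint_sym disjoints_subset subsetDr.
rewrite BPV setU1K ?notin // eqxx; split=> //=.
by apply/eqP/def_pblock; rewrite ?setU11 ?(partition_trivIset BPV).
Qed.

Lemma partition_sumU w U V : [disjoint U & V] ->
    (forall B, B \subset U :|: V ->
       ~~ (B \subset U) -> ~~ (B \subset V) -> w B = 0) ->
  partition_sum w (U :|: V) = partition_sum w U * partition_sum w V.
Proof.
have [m] := ubnP #|U|; elim: m U => // m IHm U; rewrite ltnS => U_le dUV w0.
have [->|/set0Pn[v vU]] := eqVneq U set0.
  by rewrite set0U partition_sum0 mul1r.
rewrite (@partition_sum_peel w (U :|: V) v) ?inE ?vU //.
rewrite (partition_sum_peel w vU) big_distrl /=.
rewrite (bigID (fun B => B \subset U)) /= [X in _ + X]big1 ?addr0; last first.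
  move=> B /andP[/andP[vB BUV] BU]; rewrite w0 ?mul0r //.
  by apply/subsetPn; exists v => //; rewrite (disjointFr dUV).
apply: eq_big => [B|B /andP[/andP[vB _] BU]].
  rewrite -andbA; congr (_ && _).
  by apply: andb_idl => BU; apply: subset_trans BU (subsetUl U V).
rewrite -mulrA -IHm.
- rewrite setDUl [V :\: B](setDidPl _) // disjoint_sym.
  exact: disjointWl dUV.
- apply: leq_trans U_le; rewrite proper_card // properEneq subsetDl andbT.
  by apply/eqP => /setP/(_ v); rewrite !inE vB vU.
- by apply: disjointWl dUV; rewrite subsetDl.
move=> C CUV CUB CV; apply: w0 => //.
  by apply: subset_trans CUV _; rewrite setSU ?subsetDl.
apply: contra CUB => CU; apply/subsetP => z zC; have := subsetP CUV z zC.
by rewrite inE (disjointFr dUV) ?orbF // (subsetP CU).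
Qed.

Lemma partition_sum_odd w V :
  (forall B, odd #|B| -> w B = 0) -> odd #|V| -> partition_sum w V = 0.
Proof.
move=> w0 V_odd; rewrite /partition_sum big1 // => P PV.
have [B BP B_odd] : exists2 B, B \in P & odd #|B|.
  apply/exists_inP; apply: contraLR V_odd => /exists_inPn evenP.
  rewrite (card_partition PV).
  by elim/big_ind: _ => // m n; rewrite oddD => /negPf -> /negPf ->.
by rewrite (bigD1 B) //= w0 // mul0r.
Qed.

End PartitionSum.

Section TileWeight.

Variables (A : comNzRingType) (x : A) (T : finType).
Implicit Types (G H : square_graph T) (B : {set T}) (P : {set {set T}}).

Definition tile_weight G B : A :=
  if B \in squares G then x else (B \in edges G)%:R.

Lemma prod_tile_weight G P :
  \prod_(B in P) tile_weight G B =
  if P \subset edges G :|: squares G then x ^+ #|P :&: squares G| else 0.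
Proof.
case: ifPn => [/subsetP PG|/subsetPn[B BP]]; last first.
  rewrite inE negb_or => /andP[/negPf BE /negPf BS].
  by rewrite (bigD1 B) //= /tile_weight BE BS mul0r.
rewrite (bigID (mem (squares G))) /= [X in _ * X]big1 ?mulr1; last first.
  move=> B /andP[BP /negPf BS]; have := PG B BP.
  by rewrite inE /tile_weight BS orbF => ->.
rewrite -prodr_const; apply: eq_big => [B|B /andP[_ BS]]; first by rewrite inE.
by rewrite /tile_weight BS.
Qed.

Definition induced_subgraph G H : Prop :=
  edges G = [set B in edges H | B \subset verts G] /\
  squares G = [set B in squares H | B \subset verts G].

Lemma partition_sum_induced G H : induced_subgraph G H ->
  partition_sum (tile_weight G) (verts G) =
  partition_sum (tile_weight H) (verts G).
Proof.
case=> edgesE squaresE; apply: eq_partition_sum => B; rewrite inE => BG.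
by rewrite /tile_weight edgesE squaresE !inE BG !andbT.
Qed.

End TileWeight.

Section TilingPolynomial.

Variables (R : realType) (T : finType).
Implicit Types (G : square_graph T).

Lemma F_polyE G : F_poly R G = \sum_(P | tiling G P) 'X^#|P :&: squares G|.
Proof.
apply/polyP => k; rewrite coef_poly coef_sum.
under eq_bigr do rewrite coefXn eq_sym mulrb.
rewrite -big_mkcondr /= sumr_const /face_number.
case: ltnP => [_|k_gt].
  by congr (_ *+ _); apply: eq_card => P; rewrite inE.
rewrite eq_card0 // => P; rewrite inE /=; apply/negP => /andP[_ /eqP Pk].
by move: k_gt; rewrite -Pk ltnNge subset_leq_card // subsetIr.
Qed.

Lemma P_polyE G :
  P_poly R G = partition_sum (tile_weight ('X - 1 : {poly R}) G) (verts G).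
Proof.
rewrite /P_poly F_polyE rmorph_sum big_mkcondr; apply: eq_bigr => P _ /=.
by rewrite prod_tile_weight rmorphXn /= comp_polyX.
Qed.

End TilingPolynomial.

(** * Tiles of the grid *)

Definition region n (f : nat -> nat -> bool) : {set grid n} :=
  [set v : grid n | f v.1 v.2].

Definition without (f g : nat -> nat -> bool) (a b : nat) : bool :=
  f a b && ~~ g a b.

Lemma mem_region n f a b : (a <= n)%N -> (b <= 2)%N ->
  (pt n a (inord b) \in region n f) = f a b.
Proof. by move=> an b2; rewrite inE /= !inordK. Qed.

Lemma eq_region n f g :
    (forall a b, (a <= n)%N -> (b <= 2)%N -> f a b = g a b) ->
  region n f = region n g.
Proof.
by move=> fg; apply/setP => -[a b]; rewrite !inE fg //= -ltnS ltn_ord.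
Qed.

Lemma regionD n f g : region n f :\: region n g = region n (without f g).
Proof. by apply/setP => v; rewrite !inE andbC. Qed.

(* Columns j, ..., j + w - 1 and rows y, ..., y + h - 1, where as in [grid] the
   rows are shifted by one. *)
Definition box (j y w h a b : nat) : bool :=
  (j <= a < j + w)%N && (y <= b < y + h)%N.

Lemma card_ord_interval m j w : (j + w <= m)%N ->
  #|[set i : 'I_m | j <= i < j + w]%N| = w.
Proof.
move=> le_m; rewrite -sum1_card.
under eq_bigl do rewrite inE.
rewrite -(big_ord_widen_cond m (fun i => (j <= i)%N) (fun=> 1%N)) //.
rewrite -(@big_geq_mkord _ _ addn j _ xpredT (fun=> 1%N)).
by rewrite sum_nat_const_nat muln1 addKn.
Qed.

Lemma card_region_box n j y w h : (j + w <= n.+1)%N -> (y + h <= 3)%N ->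
  #|region n (box j y w h)| = (w * h)%N.
Proof.
move=> jw yh; have -> : region n (box j y w h) =
    setX [set i : 'I_n.+1 | j <= i < j + w]%N [set i : 'I_3 | y <= i < y + h]%N.
  by apply/setP => v; rewrite !inE.
by rewrite cardsX !card_ord_interval.
Qed.

Definition tile_params : Type := (nat * nat * nat * nat)%type.

Definition in_tile (t : tile_params) : nat -> nat -> bool :=
  let: (j, y, w, h) := t in box j y w h.

Definition tile n t : {set grid n} := region n (in_tile t).

Definition is_tile n (t : tile_params) : bool :=
  let: (j, y, w, h) := t in
  [&& j + w <= n.+1, y + h <= 3, 0 < w <= 2, 0 < h <= 2 & 2 < w + h]%N.

Definition is_square (t : tile_params) : bool :=
  let: (_, _, w, h) := t in (w == 2)%N && (h == 2)%N.

(* It suffices to test the corners, since w, h <= 2 for a tile. *)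
Definition tile_sub (t : tile_params) (f : nat -> nat -> bool) : bool :=
  let: (j, y, w, h) := t in
  [&& f j y, f (j + w).-1 y, f j (y + h).-1 & f (j + w).-1 (y + h).-1].

Lemma tile_subE n f t :
  is_tile n t -> (tile n t \subset region n f) = tile_sub t f.
Proof.
case: t => [[[j y] w] h] /= t_ok.
apply/subsetP/idP => [sub|/and4P[f1 f2 f3 f4] [a b]].
  have f_in a b : box j y w h a b -> f a b.
    move=> tab; have [an b2] : (a <= n)%N /\ (b <= 2)%N.
      by move: tab; rewrite /box; lia.
    by rewrite -(mem_region _ an b2); apply: sub; rewrite mem_region.
  by rewrite !f_in // /box; lia.
rewrite !inE /= /box => tab.
have [->|->] : a = j :> nat \/ a = (j + w).-1 :> nat by lia.
  by have [->|->] : b = y :> nat \/ b = (y + h).-1 :> nat by lia.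
by have [->|->] : b = y :> nat \/ b = (y + h).-1 :> nat by lia.
Qed.

Lemma tile_inj n : {in is_tile n &, injective (tile n)}.
Proof.
move=> t u t_ok u_ok eq_tu.
have := tile_subE (in_tile u) t_ok; have := tile_subE (in_tile t) u_ok.
rewrite -!/(tile n _) -eq_tu subxx.
case: t u t_ok u_ok {eq_tu} => [[[j y] w] h] [[[j' y'] w'] h'].
rewrite !unfold_in /= /box => t_ok u_ok sub_ut sub_tu.
have [-> -> -> ->] : [/\ j = j', y = y', w = w' & h = h'] by split; lia.
by [].
Qed.

Definition grid_graph n : square_graph (grid n) := {|
  verts := setT;
  edges :=
    [set tile n (val v.1, val v.2, 2, 1)%N | v : grid n & (v.1 < n)%N] :|:
    [set tile n (val v.1, val v.2, 1, 2)%N | v : grid n & (v.2 < 2)%N];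
  squares :=
    [set tile n (val v.1, val v.2, 2, 2)%N
       | v : grid n & (v.1 < n)%N && (v.2 < 2)%N]
|}.

Lemma grid_edgeP n (B : {set grid n}) :
  reflect (exists2 t, is_tile n t && ~~ is_square t & B = tile n t)
          (B \in edges (grid_graph n)).
Proof.
apply: (iffP setUP) => [[]/imsetP[[a b] ab ->]|[[[[j y] w] h] t_ok ->]].
- exists (val a, val b, 2, 1)%N => //=.
  by move: ab; rewrite inE /=; have := ltn_ord b; lia.
- exists (val a, val b, 1, 2)%N => //=.
  by move: ab; rewrite inE /=; have := ltn_ord a; lia.
have [[jn [y2 [-> ->]]]|[jn [y2 [-> ->]]]] :
    ((j < n /\ y <= 2 /\ w = 2 /\ h = 1) \/
     (j <= n /\ y < 2 /\ w = 1 /\ h = 2))%N by move: t_ok => /=; lia.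
  left; apply/imsetP; exists (pt n j (inord y));
  by rewrite ?inE /= !inordK // ltnW.
right; apply/imsetP; exists (pt n j (inord y));
by rewrite ?inE /= !inordK // ltnW.
Qed.

Lemma grid_squareP n (B : {set grid n}) :
  reflect (exists2 t, is_tile n t && is_square t & B = tile n t)
          (B \in squares (grid_graph n)).
Proof.
apply: (iffP imsetP) => [[[a b] ab ->]|[[[[j y] w] h] t_ok ->]].
  by exists (val a, val b, 2, 2)%N => //=; move: ab; rewrite inE /=; lia.
have {t_ok} [jn [y2 [-> ->]]] : (j < n /\ y < 2 /\ w = 2 /\ h = 2)%N.
  by move: t_ok => /=; lia.
by exists (pt n j (inord y)); rewrite ?inE /= !inordK //; lia.
Qed.

Section RegionTiles.

Variables (n : nat) (f : nat -> nat -> bool).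

Lemma region_tileP (S : {set {set grid n}}) (Q : pred tile_params) :
    (forall B, reflect (exists2 t, is_tile n t && Q t & B = tile n t)
                       (B \in S)) ->
  forall B,
    reflect (exists2 t, [&& is_tile n t, Q t & tile_sub t f] & B = tile n t)
            (B \in [set B in S | B \subset region n f]).
Proof.
move=> SP B; rewrite inE; apply: (iffP andP) => -[].
  case/SP=> t /andP[t_ok Qt] ->; rewrite tile_subE // => tf.
  by exists t; rewrite ?t_ok ?Qt.
move=> t /and3P[t_ok Qt tf] ->; rewrite tile_subE //; split=> //.
by apply/SP; exists t; rewrite ?t_ok.
Qed.

Lemma region_edgeP (B : {set grid n}) :
  reflect (exists2 t, [&& is_tile n t, ~~ is_square t & tile_sub t f]
                      & B = tile n t)
          (B \in [set B in edges (grid_graph n) | B \subset region n f]).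
Proof. exact: (region_tileP (@grid_edgeP n)). Qed.

Lemma region_squareP (B : {set grid n}) :
  reflect (exists2 t, [&& is_tile n t, is_square t & tile_sub t f]
                      & B = tile n t)
          (B \in [set B in squares (grid_graph n) | B \subset region n f]).
Proof. exact: (region_tileP (@grid_squareP n)). Qed.

End RegionTiles.

(** * Tilings of regions of the grid *)

Section RegionSum.

Variables (A : comNzRingType) (x : A) (n : nat).
Implicit Types (f g : nat -> nat -> bool) (t : tile_params).

Local Notation weight := (tile_weight x (grid_graph n)).

Lemma tile_weight_tile t :
  is_tile n t -> weight (tile n t) = if is_square t then x else 1.
Proof.
move=> t_ok; rewrite /tile_weight; case: ifPn => [/grid_squareP[u]|notsq].
  by case/andP=> u_ok u_sq /(tile_inj t_ok u_ok) ->; rewrite u_sq.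
case: ifPn => t_sq; first by case/grid_squareP: notsq; exists t; rewrite ?t_ok.
by rewrite (introT (grid_edgeP _)) //; exists t; rewrite ?t_ok.
Qed.

Lemma tile_weight_neq0 (B : {set grid n}) :
  weight B != 0 -> exists2 t, is_tile n t & B = tile n t.
Proof.
rewrite /tile_weight; case: ifPn => [/grid_squareP[t /andP[t_ok _] ->] _|_].
  by exists t.
by case: (grid_edgeP B) => [[t /andP[t_ok _] ->] _|_ /eqP//]; exists t.
Qed.

Definition region_sum f : A := partition_sum weight (region n f).

Lemma eq_region_sum f g :
    (forall a b, (a <= n)%N -> (b <= 2)%N -> f a b = g a b) ->
  region_sum f = region_sum g.
Proof. by move=> fg; rewrite /region_sum (eq_region fg). Qed.

Lemma region_sum_empty f :
  (forall a b, (a <= n)%N -> (b <= 2)%N -> ~~ f a b) -> region_sum f = 1.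
Proof.
move=> f0; rewrite /region_sum (_ : region n f = set0) ?partition_sum0 //.
by apply/setP=> -[a b]; rewrite !inE; apply/negbTE/f0; rewrite -ltnS ltn_ord.
Qed.

Lemma region_sum_peel f c r ts :
    (c <= n)%N -> (r <= 2)%N -> f c r -> uniq ts ->
    (forall j y w h, ((j, y, w, h) \in ts) =
      [&& is_tile n (j, y, w, h), box j y w h c r & tile_sub (j, y, w, h) f]) ->
  region_sum f = \sum_(t <- ts)
    (if is_square t then x else 1) * region_sum (without f (in_tile t)).
Proof.
move=> cn r2 fcr ts_uniq tsP.
have tsE t : (t \in ts) = [&& is_tile n t, in_tile t c r & tile_sub t f].
  by case: t => [[[j y] w] h]; apply: tsP.
have ts_ok t : t \in ts -> is_tile n t by rewrite tsE => /and3P[].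
pose tiles := [seq tile n t | t <- ts].
have tiles_uniq : uniq tiles.
  by rewrite map_inj_in_uniq // => t u /ts_ok t_ok /ts_ok; apply: tile_inj.
have tiles_sub (B : {set grid n}) : B \in tiles ->
    (pt n c (inord r) \in B) && (B \subset region n f).
  case/mapP=> t; rewrite tsE => /and3P[t_ok tcr tf] ->.
  by rewrite mem_region // tcr tile_subE.
rewrite /region_sum (@partition_sum_peel _ _ _ _ (pt n c (inord r)));
  last by rewrite mem_region.
rewrite (bigID (mem tiles)) /= [X in _ + X]big1 ?addr0 => [|B]; last first.
  case/andP=> /andP[crB Bf]; apply: contraNeq => wB.
  have /tile_weight_neq0[t t_ok BE] : weight B != 0.
    by apply: contraNneq wB => ->; rewrite mul0r.
  rewrite {B wB}BE in crB Bf *.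
  by rewrite map_f // tsE t_ok -(mem_region _ cn r2) crB -(tile_subE f t_ok).
rewrite (eq_bigl (mem tiles)) => [|B /=]; last exact/andb_idl/tiles_sub.
rewrite -big_uniq // big_map; apply: eq_big_seq => t /ts_ok t_ok.
by rewrite tile_weight_tile // regionD.
Qed.

Lemma region_sum_split_column f c : (forall b, ~~ f c b) ->
  region_sum f = region_sum (fun a b => f a b && (a < c)%N) *
                 region_sum (fun a b => f a b && (c < a)%N).
Proof.
move=> fc; rewrite /region_sum -partition_sumU.
- congr partition_sum; apply/setP => v.
  rewrite !inE -andb_orr -neq_ltn andb_idr //.
  by move=> fv; apply: contraNneq (fc v.2) => <-.
- by rewrite -setI_eq0; apply/eqP/setP => v; rewrite !inE; lia.
move=> B; rewrite (_ : _ :|: _ = region n (fun a b => f a b && (a != c))).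
  move=> Bf BU BV; apply/eqP.
  apply: contraNT BU => /tile_weight_neq0[t t_ok BE].
  move: Bf BV; rewrite {B}BE !tile_subE //.
  by case: t t_ok => [[[j y] w] h] /=; lia.
by apply/setP => v; rewrite !inE -andb_orr -neq_ltn.
Qed.

Lemma region_sum_odd f : odd #|region n f| -> region_sum f = 0.
Proof.
apply: partition_sum_odd => B.
apply: contraTeq => /tile_weight_neq0[[[[j y] w] h] /= t_ok ->].
rewrite /tile card_region_box; try lia.
by rewrite oddM; lia.
Qed.

End RegionSum.

Arguments region_sum_peel {A x n f} c r ts.
Arguments region_sum_split_column {A x n f} c.

(** * Tiling polynomials of ladders *)

Definition notched_ladder n k : nat -> nat -> bool :=
  without (box 0 1 n.+1 2) (box k 1 2 1).

Definition ladder_with_square n k (a b : nat) : bool :=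
  box 0 1 n.+1 2 a b || box k 0 2 1 a b.

Local Ltac box_lia :=
  move=> *; rewrite /= ?inE ?xpair_eqE /= /ladder_with_square /notched_ladder
                    /without /box; lia.

Section LadderSum.

Variables (A : comNzRingType) (x : A) (n : nat).
Local Notation W := (region_sum x n).
Local Notation p := (fib_poly (1 + x)).

Lemma region_sum_ladder j m : (j + m <= n.+1)%N -> W (box j 1 m 2) = p m.
Proof.
elim/ltn_ind: m => -[|[|m]] IHm jm.
- by apply: region_sum_empty; box_lia.
- rewrite (region_sum_peel j 2 [:: (j, 1, 1, 2)%N]) //; try box_lia.
  by rewrite big_seq1 mul1r; apply: region_sum_empty; box_lia.
rewrite (region_sum_peel (j + m.+1) 2 [:: (j + m.+1, 1, 1, 2);
  (j + m, 2, 2, 1); (j + m, 1, 2, 2)]%N); try box_lia.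
rewrite !big_cons big_nil addr0 /= !mul1r fib_polySS mulrDl mul1r.
rewrite -!IHm; try lia.
congr (_ + (_ + _ * _)); try by apply: eq_region_sum; box_lia.
rewrite (region_sum_peel (j + m.+1) 1 [:: (j + m, 1, 2, 1)%N]) //; try box_lia.
by rewrite big_seq1 mul1r; apply: eq_region_sum; box_lia.
Qed.

Lemma region_sum_notched_bridged k : (k < n)%N ->
  W (without (notched_ladder n k) (box k 2 2 1)) = p k * p (n - k.+1).
Proof.
move=> kn; rewrite (region_sum_split_column k); last by box_lia.
rewrite -(@region_sum_ladder 0 k); last by lia.
rewrite -(@region_sum_ladder k.+2 (n - k.+1)); last by lia.
by congr (_ * _); apply: eq_region_sum; box_lia.
Qed.

Lemma region_sum_notched_unbridged k : (k.+1 < n)%N ->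
  W (without (notched_ladder n k.+1) (box k 2 2 1)) = 0.
Proof.
move=> kn; rewrite (region_sum_split_column k.+1); last by box_lia.
rewrite region_sum_odd ?mul0r //.
rewrite (_ : region n _ = region n (box 0 1 k 2) :|: region n (box k 1 1 1)).
  rewrite cardsU (_ : _ :&: _ = set0) ?cards0; last first.
    by apply/setP => v; rewrite !inE; box_lia.
  by rewrite !card_region_box; try lia; rewrite subn0 oddD oddM andbF.
by apply/setP => v; rewrite !inE; box_lia.
Qed.

Lemma region_sum_notched_ladder k : (k < n)%N ->
  W (notched_ladder n k) = p k * p (n - k.+1).
Proof.
case: k => [|k] kn; rewrite -region_sum_notched_bridged //.
  rewrite (region_sum_peel 0 2 [:: (0, 2, 2, 1)%N]) //; try box_lia.
  by rewrite big_seq1 mul1r.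
rewrite (region_sum_peel k.+1 2 [:: (k.+1, 2, 2, 1); (k, 2, 2, 1)]%N);
  try box_lia.
rewrite big_cons big_seq1 /= !mul1r.
by rewrite [X in _ + X]region_sum_notched_unbridged ?addr0.
Qed.

Lemma region_sum_ladder_with_square k : (k < n)%N ->
  W (ladder_with_square n k) = p n.+1 + (1 + x) * (p k * p (n - k.+1)).
Proof.
move=> kn; rewrite (region_sum_peel k.+1 0
  [:: (k.+1, 0, 1, 2); (k, 0, 2, 1); (k, 0, 2, 2)]%N); try box_lia.
rewrite !big_cons big_nil addr0 /= !mul1r.
rewrite (region_sum_peel k 0 [:: (k, 0, 1, 2)]%N) //; try box_lia.
rewrite big_seq1 mul1r mulrDl mul1r addrCA -(@region_sum_ladder 0 n.+1) //.
rewrite -region_sum_notched_ladder //.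
by congr (_ + (_ + _ * _)); apply: eq_region_sum; box_lia.
Qed.

End LadderSum.

Lemma horizontal_pair_tile n j y : (j < n)%N -> (y <= 2)%N ->
  [set pt n j (inord y); pt n j.+1 (inord y)] = tile n (j, y, 2, 1)%N.
Proof.
move=> jn y2; apply/setP => -[a b]; rewrite !inE !xpair_eqE -!val_eqE /=.
by rewrite !inordK /box; lia.
Qed.

Lemma vertical_pair_tile n j y : (j <= n)%N -> (y < 2)%N ->
  [set pt n j (inord y); pt n j (inord y.+1)] = tile n (j, y, 1, 2)%N.
Proof.
move=> jn y2; apply/setP => -[a b]; rewrite !inE !xpair_eqE -!val_eqE /=.
by rewrite !inordK /box; lia.
Qed.

Lemma square_tile n j y : (j < n)%N -> (y < 2)%N ->
  [set pt n j (inord y); pt n j.+1 (inord y);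
       pt n j (inord y.+1); pt n j.+1 (inord y.+1)] = tile n (j, y, 2, 2)%N.
Proof.
move=> jn y2; apply/setP => -[a b]; rewrite !inE !xpair_eqE -!val_eqE /=.
by rewrite !inordK /box; lia.
Qed.

Lemma verts_ladder n : verts (ladder n) = region n (box 0 1 n.+1 2).
Proof.
apply/setP => -[a b]; rewrite !inE /box /=.
apply/orP/idP => [[]/imsetP[j _ [_ ->]]|b0]; rewrite ?inordK ?add0n ?ltn_ord //.
have ptE y : y = b :> nat -> (a, b) = pt n a (inord y).
  by move=> ->; congr (_, _); apply: val_inj; rewrite /= inordK // ltn_ord.
have [b1|b2] : b = 1%N :> nat \/ b = 2%N :> nat by have := ltn_ord b; lia.
  by left; apply/imsetP; exists a; rewrite // (ptE 1%N).
by right; apply/imsetP; exists a; rewrite // (ptE 2).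
Qed.

Lemma edges_ladder n : edges (ladder n) =
  [set B in edges (grid_graph n) | B \subset verts (ladder n)].
Proof.
apply/setP => B; rewrite verts_ladder.
apply/idP/region_edgeP => [|[[[[j y] w] h] t_ok ->]].
  case/setUP=> [/setUP[]|] /imsetP[[j jn] _ ->] /=.
  - by exists (j, 1, 2, 1)%N; rewrite ?horizontal_pair_tile //; box_lia.
  - by exists (j, 2, 2, 1)%N; rewrite ?horizontal_pair_tile //; box_lia.
  - by exists (j, 1, 1, 2)%N; rewrite ?vertical_pair_tile //; box_lia.
have [[jn [-> [-> ->]]]|[[jn [-> [-> ->]]]|[jn [-> [-> ->]]]]] :
    ((j < n /\ y = 1 /\ w = 2 /\ h = 1) \/
     (j < n /\ y = 2 /\ w = 2 /\ h = 1) \/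
     (j < n.+1 /\ y = 1 /\ w = 1 /\ h = 2))%N.
  by move: t_ok; rewrite /= /box; lia.
- rewrite -horizontal_pair_tile //; apply/setUP; left; apply/setUP; left.
  by apply/imsetP; exists (Ordinal jn).
- rewrite -horizontal_pair_tile //; apply/setUP; left; apply/setUP; right.
  by apply/imsetP; exists (Ordinal jn).
- rewrite -vertical_pair_tile //; apply/setUP; right.
  by apply/imsetP; exists (Ordinal jn).
Qed.

Lemma squares_ladder n : squares (ladder n) =
  [set B in squares (grid_graph n) | B \subset verts (ladder n)].
Proof.
have quadE (j : 'I_n) : [set pt n j Defs.row0; pt n j.+1 Defs.row0;
    pt n j Defs.row1; pt n j.+1 Defs.row1] = tile n (val j, 1, 2, 2)%N.
  exact: square_tile.
apply/setP => B; rewrite verts_ladder.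
apply/imsetP/region_squareP => [[j _ ->]|].
  by exists (val j, 1, 2, 2)%N; rewrite ?quadE //; have := ltn_ord j; box_lia.
case=> [[[[j y] w] h] t_ok ->].
have [jn [-> [-> ->]]] : (j < n /\ y = 1 /\ w = 2 /\ h = 2)%N.
  by move: t_ok; rewrite /= /box; lia.
by exists (Ordinal jn); rewrite ?quadE.
Qed.

Lemma ladder_induced n : induced_subgraph (ladder n) (grid_graph n).
Proof. by split; [apply: edges_ladder | apply: squares_ladder]. Qed.

Section LadderPlus.

Variables n k : nat.
Hypothesis kn : (k < n)%N.

Lemma verts_ladder_plus :
  verts (ladder_plus n k.+1) = region n (ladder_with_square n k).
Proof.
rewrite -[LHS]/(verts (ladder n) :|: _) verts_ladder.
apply/setP => -[a b]; rewrite !inE !xpair_eqE -!val_eqE /=.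
by rewrite /ladder_with_square /box !inordK; lia.
Qed.

Lemma edges_ladder_plus : edges (ladder_plus n k.+1) =
  [set B in edges (grid_graph n) | B \subset verts (ladder_plus n k.+1)].
Proof.
have -> : edges (ladder_plus n k.+1) = edges (ladder n) :|:
    [set tile n (k, 0, 1, 2); tile n (k, 0, 2, 1); tile n (k.+1, 0, 1, 2)]%N.
  rewrite -horizontal_pair_tile // -!vertical_pair_tile //; last exact: ltnW.
  by rewrite [in RHS](setUC [set pt n k _]).
rewrite edges_ladder verts_ladder verts_ladder_plus.
apply/setP => B; rewrite in_setU; apply/orP/region_edgeP.
  case=> [/region_edgeP[[[[j y] w] h] t_ok ->]|].
    exists (j, y, w, h) => //.
    by move: t_ok; rewrite /= /ladder_with_square /box; lia.
  rewrite !inE -orbA => /or3P[]/eqP ->.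
  - by exists (k, 0, 1, 2)%N; first box_lia.
  - by exists (k, 0, 2, 1)%N; first box_lia.
  - by exists (k.+1, 0, 1, 2)%N; first box_lia.
case=> [[[[j y] w] h] t_ok ->].
have [y_gt0|[-> jwh]] : (0 < y)%N \/ y = 0%N /\
    ((j = k /\ w = 1 /\ h = 2) \/ (j = k /\ w = 2 /\ h = 1) \/
     (j = k.+1 /\ w = 1 /\ h = 2))%N.
- by move: t_ok; rewrite /= /ladder_with_square /box; lia.
- left; apply/region_edgeP; exists (j, y, w, h) => //.
  by move: t_ok; rewrite /= /ladder_with_square /box; lia.
right; rewrite !inE.
by case: jwh => [[-> [-> ->]]|[[-> [-> ->]]|[-> [-> ->]]]]; rewrite eqxx ?orbT.
Qed.

Lemma squares_ladder_plus : squares (ladder_plus n k.+1) =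
  [set B in squares (grid_graph n) | B \subset verts (ladder_plus n k.+1)].
Proof.
have -> : squares (ladder_plus n k.+1) =
    squares (ladder n) :|: [set tile n (k, 0, 2, 2)%N].
  rewrite -square_tile //; congr (_ :|: [set (_ : {set grid n})]).
  by rewrite -setUA setUC setUA.
rewrite squares_ladder verts_ladder verts_ladder_plus.
apply/setP => B; rewrite in_setU; apply/orP/region_squareP.
  case=> [/region_squareP[[[[j y] w] h] t_ok ->]|/set1P->].
    exists (j, y, w, h) => //.
    by move: t_ok; rewrite /= /ladder_with_square /box; lia.
  by exists (k, 0, 2, 2)%N; first box_lia.
case=> [[[[j y] w] h] t_ok ->].
have [y_gt0|[-> [-> [-> ->]]]] :
    (0 < y \/ y = 0 /\ j = k /\ w = 2 /\ h = 2)%N.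
- by move: t_ok; rewrite /= /ladder_with_square /box; lia.
- left; apply/region_squareP; exists (j, y, w, h) => //.
  by move: t_ok; rewrite /= /ladder_with_square /box; lia.
by right; rewrite set11.
Qed.

Lemma ladder_plus_induced :
  induced_subgraph (ladder_plus n k.+1) (grid_graph n).
Proof. by split; [apply: edges_ladder_plus | apply: squares_ladder_plus]. Qed.

End LadderPlus.

Section LadderPolynomials.

Variable R : realType.
Local Notation p := (fib_poly ('X : {poly R})).

Lemma P_poly_induced n (G : square_graph (grid n)) f :
    induced_subgraph G (grid_graph n) -> verts G = region n f ->
  P_poly R G = region_sum ('X - 1) n f.
Proof. by move=> GH VG; rewrite P_polyE (partition_sum_induced _ GH) VG. Qed.

Lemma P_ladderE n : P_ladder R n = p n.+1.
Proof.
rewrite /P_ladder (P_poly_induced (ladder_induced n) (verts_ladder n)).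
by rewrite region_sum_ladder // addrC subrK.
Qed.

Lemma P_ladder_plusE n k : (k < n)%N ->
  P_ladder_plus R n k.+1 = p n.+1 + 'X * (p k * p (n - k.+1)).
Proof.
move=> kn; rewrite /P_ladder_plus.
rewrite (P_poly_induced (ladder_plus_induced kn) (verts_ladder_plus kn)).
by rewrite region_sum_ladder_with_square // addrCA subrr addr0.
Qed.

End LadderPolynomials.

Theorem theorem4p9 (R : realType) (d : nat) (hd : (0 < d)%N) :
  affinely_independent
    ([:: P_ladder R (2 * d - 1); P_ladder R (2 * d)]
       ++ [seq P_ladder_plus R (2 * d - 1) i | i <- iota 1 (d - 1)]).
Proof.
case: d hd => // N _; pose p := fib_poly ('X : {poly R}).
have -> : (2 * N.+1 = N.*2.+2)%N by lia.
rewrite !subSS !subn0.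
pose s := p N.*2.+1 :: mkseq (fun j => p j * p (N.*2 - j)%N) N.
suff -> : [:: P_ladder R N.*2.+1; P_ladder R N.*2.+2] ++
    [seq P_ladder_plus R N.*2.+1 i | i <- iota 1 N] =
    p N.*2.+2 :: [seq p N.*2.+2 + v | v <- [seq 'X * v | v <- s]].
  apply/affinely_independent_translate/linearly_independent_mull.
    exact: (mulfI (negbT (polyX_eq0 R))).
  exact: linearly_independent_fib_polyM.
rewrite /s /= !P_ladderE -!map_comp (iotaDl 1 0) -map_comp.
congr [:: _, _ & _]; apply/eq_in_map => j; rewrite mem_iota /= => jN.
by rewrite P_ladder_plusE ?subSS //; lia.
Qed.
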